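(* Denote the local cost at node $i$ at the beginning of iteration $k$ of the power allocation algorithm (described in the context) by $D_i^k=\sum_{j\in\mathcal O(i)}D_{ij}^k$. Then for all $\lambda\in[0,1]$ the Hessian matrix $H^{k,\lambda}_{\boldsymbol\eta_i}=\nabla^2D(\boldsymbol\eta_i)\big|_{\lambda\boldsymbol\eta_i^k+(1-\lambda)\boldsymbol\eta_i^{k+1}}$ is upper bounded by the diagonal matrix $\bar Q_i^k=\mathrm{diag}\{(\beta_{ij})_{j\in\mathcal O(i)}\}$, in the sense that for all $\boldsymbol v_i\in\mathcal V_{\boldsymbol\eta_i}=\{\boldsymbol y_i:\sum_{j\in\mathcal O(i)}y_{ij}=0\}$, $$\boldsymbol v_i'\cdot H^{k,\lambda}_{\boldsymbol\eta_i}\cdot\boldsymbol v_i\le\boldsymbol v_i'\cdot\bar Q_i^k\cdot\boldsymbol v_i,$$ where $$\beta_{ij}=\frac{1}{\underline\eta_{ij}^2}\left[B_{ij}(D_i^k)\max_{x_{ij}^{min}\le x\le x_{ij}^{max}}\{C'(x)^2x^2(1+x)^2\}+\frac{\partial D_{ij}}{\partial C_{ij}}\bigg|_{D_{ij}(C_{ij},F_{ij}^k)=D_i^k}\cdot\min_{x_{ij}^{min}\le x\le x_{ij}^{max}}\{C''(x)x^2(1+x)^2\}\right].$$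
   Context: $(\mathcal N,\mathcal E)$ is a finite directed graph, $\mathcal O(i)=\{j:(i,j)\in\mathcal E\}$. Network cost $D=\sum_{(i,j)\in\mathcal E}D_{ij}(C_{ij},F_{ij})$; on $\{0\le F<C\}$ each $D_{ij}$ is nonnegative, twice continuously differentiable, with $\partial D_{ij}/\partial C_{ij}<0$, $\partial D_{ij}/\partial F_{ij}>0$, $\partial^2D_{ij}/\partial C_{ij}^2\ge0$, $\partial^2D_{ij}/\partial F_{ij}^2\ge0$; $D_{ij}\to\infty$ as $F_{ij}\to C_{ij}^-$, and $D_{ij}=\infty$ if $F_{ij}\ge C_{ij}$. $D_{ij}^k$ and $F_{ij}^k$ are the cost and flow of link $(i,j)$ before iteration $k$. Node $i$ has total power $P_i$ split as $P_{ij}=P_i\eta_{ij}$, $\eta_{ij}\ge0$, $\sum_{j\in\mathcal O(i)}\eta_{ij}=1$; $\boldsymbol\eta_i=(\eta_{ij})_{j\in\mathcal O(i)}$. $N_j$ are noise powers and $G_{mj}$ constant path gains. The capacity function $C(\cdot)$ is strictly increasing, concave, twice continuously differentiable on $(0,\infty)$, with $C''(x)x+C'(x)\le0$. During a power allocation iteration at node $i$, all flows, all total powers and the other nodes' allocations are fixed, so only $C_{ij}$, $j\in\mathcal O(i)$, vary, and $$C_{ij}=C_{ij}(\eta_{ij})=C(x_{ij}),\qquad x_{ij}=\frac{G_{ij}P_i\eta_{ij}}{IN_{ij}},\qquad IN_{ij}=G_{ij}P_i(1-\eta_{ij})+\sum_{m\ne i}G_{mj}P_m+N_j.$$ $D(\boldsymbol\eta_i)$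 is the network cost as a function of $\boldsymbol\eta_i$ through these expressions. Quantities. $\underline\eta_{ij}$ is the lower bound on the updated value of $\eta_{ij}$ for which $D_{ij}(C_{ij}(\underline\eta_{ij}),F_{ij}^k)=D_i^k$; $x_{ij}^{min}$ is the value of $x_{ij}$ at $\eta_{ij}=\underline\eta_{ij}$; $x_{ij}^{max}=G_{ij}P_i/(\sum_{m\ne i}G_{mj}P_m+N_j)$; $B_{ij}(D_i^k)=\max_{D_{ij}(C_{ij},F_{ij}^k)\le D_i^k}\partial^2D_{ij}/\partial C_{ij}^2$. Power allocation algorithm: $\boldsymbol\eta_i^{k+1}$ minimizes $\delta{\boldsymbol\eta_i^k}'(\boldsymbol\eta_i-\boldsymbol\eta_i^k)+\frac12(\boldsymbol\eta_i-\boldsymbol\eta_i^k)'Q_i^k(\boldsymbol\eta_i-\boldsymbol\eta_i^k)$ over $\boldsymbol\eta_i\ge0$, $\sum_{j\in\mathcal O(i)}\eta_{ij}=1$, where $\delta\boldsymbol\eta_i=(\delta\eta_{ij})_{j\in\mathcal O(i)}$, $\delta\eta_{ij}=\frac{\partial D_{ij}}{\partial C_{ij}}\frac{C'(x_{ij})G_{ij}}{IN_{ij}}(1+x_{ij})$, and $Q_i^k$ is the scaling matrix of the algorithm, on which the lemma imposes no specific choice. *)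

(* Defs.v *)
From HB Require Import structures.
From mathcomp Require Import all_boot all_order all_algebra.
From mathcomp Require Import all_classical all_reals all_analysis.

Set Implicit Arguments.
Unset Strict Implicit.
Unset Printing Implicit Defensive.

Import Order.TTheory GRing.Theory Num.Theory.
Import numFieldNormedType.Exports.

Local Open Scope classical_set_scope.
Local Open Scope ring_scope.

Section partial_derivatives.
Variable R : realType.
Implicit Types (d : R -> R -> R) (c f : R).

(* A link cost [d c f] takes the capacity first; pairs [p] are (c, f). *)
Definition cost_domain : set (R * R) := [set p | 0 <= p.2 < p.1].

Definition dcap d : R -> R -> R := fun c f => derive1 (fun c' => d c' f) c.

(* The flow derivative is relative to [f >= 0]: it is two-sided for [f > 0],
   and the right derivative at [f = 0], on the boundary of [cost_domain]. *)
Definition flow_quotients d c f : set_system R :=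
  (h^-1 * (d c (f + h) - d c f)) @[h --> within [set h | 0 <= f + h] 0^'].

Definition dflow d : R -> R -> R := fun c f => lim (flow_quotients d c f).

Definition continuous_on_domain d : Prop :=
  {within cost_domain, continuous (fun p : R * R => d p.1 p.2)}.

Definition C1_on_domain d : Prop :=
  [/\ forall c f, cost_domain (c, f) -> derivable (fun c' => d c' f) c 1,
      forall c f, cost_domain (c, f) -> cvg (flow_quotients d c f),
      continuous_on_domain d,
      continuous_on_domain (dcap d)
    & continuous_on_domain (dflow d)].

Definition C2_on_domain d : Prop :=
  [/\ C1_on_domain d, C1_on_domain (dcap d) & C1_on_domain (dflow d)].

Record cost_function d : Prop := CostFunction {
  cost_ge0 : forall c f : R, 0 <= f < c -> 0 <= d c f;
  cost_C2 : C2_on_domain d;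
  cost_dcap_lt0 : forall c f : R, 0 <= f < c -> dcap d c f < 0;
  cost_dflow_gt0 : forall c f : R, 0 <= f < c -> 0 < dflow d c f;
  cost_dcap2_ge0 : forall c f : R, 0 <= f < c -> 0 <= dcap (dcap d) c f;
  cost_dflow2_ge0 : forall c f : R, 0 <= f < c -> 0 <= dflow (dflow d) c f;
  cost_barrier : forall c : R, 0 < c -> d c f @[f --> c^'-] --> +oo
}.

(* The value of [d] outside [cost_domain] is irrelevant: the cost of a link is
   infinite as soon as its flow reaches its capacity. *)
Definition extended_cost d (c : \bar R) f : \bar R :=
  (if f%:E < c then (d (fine c) f)%:E else +oo)%E.

Record capacity_function (C : R -> R) : Prop := CapacityFunction {
  capacity_increasing : forall x y : R, 0 < x -> x < y -> C x < C y;
  capacity_concave :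
    convex_function (E := R^o) [set x : R^o | 0 < x] (fun x => - C x);
  capacity_derivable : forall x : R, 0 < x -> derivable C x 1;
  capacity_derivable2 : forall x : R, 0 < x -> derivable (derive1 C) x 1;
  capacity_C2 : forall x : R, 0 < x -> {for x, continuous (derive1n 2 C)};
  capacity_curvature : forall x : R, 0 < x -> derive1n 2 C x * x + derive1 C x <= 0
}.

(* [C] is only defined on positive reals. The inequality C''(x)x + C'(x) <= 0
   makes C'(x)x nonincreasing, so C(x) tends to -oo as x tends to 0+; this is
   the value taken at a link that receives no power. *)
Definition extended_capacity (C : R -> R) (x : R) : \bar R :=
  (if (0 < x)%R then (C x)%:E else -oo)%E.

End partial_derivatives.

Record network (R : realType) := Network {
  node : finType;
  link : rel node;
  cost : node -> node -> R -> R -> R;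
  capacity : R -> R;
  power : node -> R;
  gain : node -> node -> R;
  noise : node -> R;
  flow : node -> node -> R
}.

Record network_ok (R : realType) (net : network R) : Prop := NetworkOk {
  ok_cost : forall i j : node net, link i j -> cost_function (cost i j);
  ok_capacity : capacity_function (capacity net);
  ok_power : forall i : node net, 0 <= power i;
  ok_gain : forall i j : node net, 0 <= gain i j;
  ok_noise : forall j : node net, 0 < noise j;
  ok_flow : forall i j : node net, link i j -> 0 <= flow i j
}.

Section power_allocation.
Variables (R : realType) (net : network R).
Implicit Types (i m : node net).

Definition out i : {set node net} := [set j | link i j].

(* Vectors indexed by O(i) are row vectors of size #|O(i)|: coordinate [a]
   belongs to the neighbour [nbr a], where [a] ranges over ['I_#|O(i)|]. *)
Definition alloc i : Type := 'rV[R]_#|out i|.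

Definition nbr i (a : 'I_#|out i|) : node net := enum_val a.

Definition simplex i : set (alloc i) :=
  [set y | (forall a, 0 <= y 0 a) /\ \sum_a y 0 a = 1].

Section link.
Variables (i : node net) (a : 'I_#|out i|).
Let j := nbr a.

Definition background : R :=
  \sum_(m | m != i) gain m j * power m + noise j.

Definition interference (t : R) : R :=
  gain i j * power i * (1 - t) + background.

Definition sinr (t : R) : R := gain i j * power i * t / interference t.

Definition sinr_max : R := gain i j * power i / background.

Definition link_capacity (t : R) : \bar R :=
  extended_capacity (capacity net) (sinr t).

Definition link_cost_at (c : \bar R) : \bar R :=
  extended_cost (cost i j) c (flow i j).

Definition link_cost (t : R) : \bar R := link_cost_at (link_capacity t).

(* Coordinate of delta eta_i. *)
Definition marginal_cost (t : R) : R :=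
  let x := sinr t in
  dcap (cost i j) (capacity net x) (flow i j) *
  (derive1 (capacity net) x * gain i j / interference t) * (1 + x).

(* The values whose maximum is B_ij(D). *)
Definition curvatures (D : \bar R) : set R :=
  [set dcap (dcap (cost i j)) c (flow i j) | c in
     [set c | (link_cost_at c%:E <= D)%E]].

(* The capacity at which the cost of the link is D; it is unique for finite D,
   the cost being strictly decreasing in the capacity. *)
Definition level_capacity (D : \bar R) : R :=
  get [set c : R | link_cost_at c%:E = D].

(* [low] is the lower bound on eta_ij. The last two extrema are over a compact
   interval of positive reals, where C' and C'' are continuous, hence [sup] and
   [inf] are a maximum and a minimum. *)
Definition beta (D : \bar R) (low : R) : R :=
  let C := capacity net in
  let I := `[sinr low, sinr_max]%classic in
  (low ^+ 2)^-1 *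
  (sup (curvatures D) *
     sup [set derive1 C x ^+ 2 * x ^+ 2 * (1 + x) ^+ 2 | x in I] +
   dcap (cost i j) (level_capacity D) (flow i j) *
     inf [set derive1n 2 C x * x ^+ 2 * (1 + x) ^+ 2 | x in I]).

End link.

Definition local_cost i (y : alloc i) : \bar R :=
  (\sum_a link_cost a (y ord0 a))%E.

Definition network_cost (eta : forall m, alloc m) : \bar R :=
  (\sum_m local_cost (eta m))%E.

(* The network cost as a real function of the allocation at node [i], those of
   the other nodes being given by [eta]. *)
Definition cost_of_alloc (eta : forall m, alloc m) i : alloc i -> R :=
  fun y => fine (network_cost (@dfwith (node net) alloc eta i y)).

Definition marginal_costs i (y : alloc i) : alloc i :=
  \row_a marginal_cost a (y 0 a).

Definition quad n (Q : 'M[R]_n) (v : 'rV[R]_n) : R := (v *m Q *m v^T) 0 0.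

Definition iteration_objective i (Q : 'M[R]_#|out i|) (eta y : alloc i) : R :=
  (marginal_costs eta *m (y - eta)^T) 0 0 + 2^-1 * quad Q (y - eta).

Definition power_allocation_step i (Q : 'M[R]_#|out i|) (eta y : alloc i) :
    Prop :=
  @simplex i y /\
  forall z, @simplex i z ->
    iteration_objective Q eta y <= iteration_objective Q eta z.

(* The matrix diag(beta_ij), with [D] the local cost at [i]. *)
Definition beta_mx i (D : \bar R) (low : alloc i) : 'M[R]_#|out i| :=
  diag_mx (\row_a beta a D (low 0 a)).

End power_allocation.

Definition hessian (R : realType) n (g : 'rV[R]_n -> R) (x : 'rV[R]_n) :
    'M[R]_n :=
  \matrix_(a, b) 'D_(delta_mx 0 b) ('D_(delta_mx 0 a) g) x.

(* Main.v *)
Require Import Defs.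
From mathcomp Require Import all_boot all_order all_algebra.
From mathcomp Require Import all_classical all_reals all_analysis.
From mathcomp Require Import ring lra.

Set Implicit Arguments.
Unset Strict Implicit.
Unset Printing Implicit Defensive.

Import Order.TTheory GRing.Theory Num.Theory.
Import numFieldNormedType.Exports.

Local Open Scope classical_set_scope.
Local Open Scope ring_scope.

(** Only the capacities of the links leaving [i] depend on the allocation, and
    each depends on its own coordinate alone, so the Hessian is diagonal with
    entries [h''(t)], where [h t = d (C (x t)) f]. As [x' = x (1 + x) / t],
    the chain rule gives
      [h'' = t^-2 (d_cc C'^2 x^2 (1+x)^2 + d_c C'' x^2 (1+x)^2) + d_c C' x''],
    whose last term is nonpositive because [d_c < 0 <= C'] and [0 <= x''].
    Since [d] decreases with the capacity, every allocation between the current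
    and the next one costs link [ij] at most [D_i^k] and is at least [low],
    so each remaining factor is bounded by the matching factor of [beta],
    using [C'' <= 0] (from [C'' x + C' <= 0]) for the term in [C'']. *)

(** * Derivatives and Hessians of separable functions *)

Lemma eq_lim_quotient (R : realType) (q q' : R -> R) :
  q =1 q' -> lim (q @ 0^') = lim (q' @ 0^').
Proof. by move=> /funext ->. Qed.

Section separable_functions.
Variables (R : realType) (n : nat).
Implicit Types (a b : 'I_n) (y z v : 'rV[R]_n) (h : 'I_n -> R -> R).

Lemma add_delta_coord (t : R) a b y :
  (t *: delta_mx 0 a + y) 0 b = (if b == a then t else 0) + y 0 b.
Proof. by rewrite !mxE eqxx /=; case: eqP; rewrite ?mulr1 ?mulr0. Qed.

(** Along another coordinate direction the function is constant, which is why mixed second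
    derivatives vanish. *)
Lemma derive_coord_comp (k : R -> R) a b y :
  'D_(delta_mx 0 b) (fun y' => k (y' 0 a)) y =
  if a == b then derive1 k (y 0 a) else 0.
Proof.
case: ifPn => [/eqP <-|neq_ab].
  apply: eq_lim_quotient => t /=.
  by rewrite add_delta_coord eqxx.
rewrite -(derive_cst (k (y 0 a)) y (delta_mx 0 b)) /derive.
apply: eq_lim_quotient => t /=.
by rewrite add_delta_coord (negPf neq_ab) add0r.
Qed.

(* The two difference quotients coincide, so derivability is irrelevant. *)
Lemma derive_separable (c : R) h a y :
  'D_(delta_mx 0 a) (fun y' => c + \sum_b h b (y' 0 b)) y =
  derive1 (h a) (y 0 a).
Proof.
apply: eq_lim_quotient => t /=.
congr (_ *: _); rewrite (bigD1 a) //= [in X in _ - X](bigD1 a) //=.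
rewrite add_delta_coord eqxx.
rewrite [X in h a (t + _) + X](eq_bigr (fun b => h b (y 0 b))) => [|b nab].
  by ring.
by rewrite add_delta_coord (negPf nab) add0r.
Qed.

Lemma hessian_separable (g : 'rV[R]_n -> R) (c : R) h z :
  (\forall y \near z, g y = c + \sum_b h b (y 0 b)) ->
  hessian g z = diag_mx (\row_a derive1 (derive1 (h a)) (z 0 a)).
Proof.
(* [near_join] gives the formula around every point near [z], so the first derivatives are known on
   a neighbourhood, as differentiating again requires. *)
move=> /near_join geq; apply/matrixP => a b; rewrite !mxE.
rewrite (@near_eq_derive _ _ _ _ (fun y => derive1 (h a) (y 0 a))).
  by rewrite derive_coord_comp; case: eqP => [->|_]; rewrite ?mulr1n ?mulr0n.
apply: filterS geq => y gy.
by rewrite (near_eq_derive _ gy) derive_separable.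
Qed.

Lemma quad_diag_mx (d v : 'rV[R]_n) :
  quad (diag_mx d) v = \sum_a d 0 a * v 0 a ^+ 2.
Proof.
rewrite /quad mxE; apply: eq_bigr => a _.
by rewrite mul_mx_diag !mxE; ring.
Qed.

End separable_functions.

(** * Monotonicity of a link cost and of its derivative in the capacity *)

Section cost_functions.
Variables (R : realType) (d : R -> R -> R) (f : R).
Hypotheses (d_ok : cost_function d) (f_ge0 : 0 <= f).
Implicit Types c : R.

Lemma cost_is_derive c : f < c -> is_derive c 1 (d^~ f) (dcap d c f).
Proof.
move=> fc; have [[dd _ _ _ _] _ _] := cost_C2 d_ok.
by rewrite /dcap derive1E; apply/derivableP/dd; rewrite /cost_domain /= f_ge0.
Qed.

Lemma dcap_is_derive c :
  f < c -> is_derive c 1 ((dcap d)^~ f) (dcap (dcap d) c f).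
Proof.
move=> fc; have [_ [dd _ _ _ _] _] := cost_C2 d_ok.
by rewrite [dcap (dcap d)]/dcap derive1E; apply/derivableP/dd;
  rewrite /cost_domain /= f_ge0.
Qed.

Let gt_flow c c' x : f < c -> x \in `[c, c']%R -> f < x.
Proof. by move=> fc; rewrite in_itv/= => /andP[/(lt_le_trans fc)]. Qed.

Lemma cost_decreasing c c' : f < c -> c < c' -> d c' f < d c f.
Proof.
move=> fc cc'.
apply: (@ltr0_derive1_lt_cc _ (d^~ f) c c'); rewrite ?in_itv/= ?lexx ?ltW//.
- by move=> x /subset_itv_oo_cc/(gt_flow fc)/cost_is_derive[].
- move=> x /subset_itv_oo_cc/(gt_flow fc) fx.
  by apply: (cost_dcap_lt0 d_ok); rewrite f_ge0.
- by apply: derivable_within_continuous => x /(gt_flow fc)/cost_is_derive[].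
Qed.

Lemma dcap_nondecreasing c c' : f < c -> c <= c' -> dcap d c f <= dcap d c' f.
Proof.
move=> fc cc'.
apply: (@ger0_derive1_le_cc _ ((dcap d)^~ f) c c');
  rewrite ?in_itv/= ?lexx ?cc'//.
- by move=> x /subset_itv_oo_cc/(gt_flow fc)/dcap_is_derive[].
- move=> x /subset_itv_oo_cc/(gt_flow fc) fx.
  by apply: (cost_dcap2_ge0 d_ok); rewrite f_ge0.
- by apply: derivable_within_continuous => x /(gt_flow fc)/dcap_is_derive[].
Qed.

Lemma capacity_le_of_cost_ge c c' : f < c' -> d c' f <= d c f -> c <= c'.
Proof.
by move=> fc' dc'c; rewrite leNgt; apply/negP => /(cost_decreasing fc');
  rewrite ltNge dc'c.
Qed.

End cost_functions.

(** * Signs of [C'] and [C''], and the extrema in [beta] *)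

Section capacity_functions.
Variables (R : realType) (C : R -> R).
Hypothesis C_ok : capacity_function C.

Lemma capacity_is_derive (x : R) : 0 < x -> is_derive x 1 C (derive1 C x).
Proof.
by move=> x0; rewrite derive1E; apply/derivableP/(capacity_derivable C_ok).
Qed.

Lemma derive1_capacity_is_derive (x : R) :
  0 < x -> is_derive x 1 (derive1 C) (derive1n 2 C x).
Proof.
move=> x0; rewrite [derive1n 2 C x]derive1E.
exact/derivableP/(capacity_derivable2 C_ok).
Qed.

Lemma derive1_capacity_ge0 (x : R) : 0 < x -> 0 <= derive1 C x.
Proof.
move=> x0; apply: (@incr_derive1_ge0_itvy _ C false 0); rewrite ?in_itv/= ?x0//.
- by move=> y; rewrite inE/= in_itv/= andbT; exact: capacity_derivable.
- move=> y z; rewrite !in_itv/= !andbT => y0 _; exact: capacity_increasing.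
Qed.

Lemma derive2_capacity_le0 (x : R) : 0 < x -> derive1n 2 C x <= 0.
Proof.
move=> x0; rewrite -(pmulr_lle0 _ x0).
have := capacity_curvature C_ok x0; have := derive1_capacity_ge0 x0; lra.
Qed.

Section compact_interval.
Variables lo hi : R.
Hypothesis lo_gt0 : 0 < lo.

Let pos x : x \in `[lo, hi]%R -> 0 < x.
Proof. by rewrite in_itv/= => /andP[/(lt_le_trans lo_gt0)]. Qed.

Let weight_continuous (g : R -> R) (x : R) :
  {for x, continuous g} ->
  {for x, continuous (fun x => g x * x ^+ 2 * (1 + x) ^+ 2)}.
Proof.
move=> gx; apply: cvgM; first apply: cvgM => //.
  exact: exprn_continuous.
apply: (@continuous_comp _ _ _ (fun x : R => 1 + x) (fun y => y ^+ 2)).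
  by apply: cvgD; [exact: cvg_cst|exact: cvg_id].
exact: exprn_continuous.
Qed.

(** The extreme value theorem bounds the set, so that its [sup] and [inf] really bound its
    elements. *)
Let continuous_extrema (g : R -> R) :
  (forall x, 0 < x -> {for x, continuous g}) ->
  let E := [set g x * x ^+ 2 * (1 + x) ^+ 2 | x in `[lo, hi]%classic] in
  has_ubound E /\ has_lbound E.
Proof.
move=> gc E.
have [lohi|hilo] := leP lo hi; last first.
  have -> : E = set0 by rewrite /E set_itv_ge ?image_set0// bnd_simp -ltNge.
  by split; exists 0.
have wc : {within `[lo, hi], continuous
    (fun x => g x * x ^+ 2 * (1 + x) ^+ 2)}.
  apply: continuous_in_subspaceT => x /[!inE] /= xi.
  exact/weight_continuous/gc/pos.
split.
  have [m _ le_m] := EVT_max lohi wc.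
  by exists (g m * m ^+ 2 * (1 + m) ^+ 2) => _ [x xi <-]; exact: le_m.
have [m _ le_m] := EVT_min lohi wc.
by exists (g m * m ^+ 2 * (1 + m) ^+ 2) => _ [x xi <-]; exact: le_m.
Qed.

Lemma derive1_capacity_le_sup (x : R) : lo <= x <= hi ->
  derive1 C x ^+ 2 * x ^+ 2 * (1 + x) ^+ 2 <=
  sup [set derive1 C x ^+ 2 * x ^+ 2 * (1 + x) ^+ 2 | x in `[lo, hi]%classic].
Proof.
move=> xi; apply: ub_le_sup; last by exists x; rewrite //= in_itv.
have [|//] := @continuous_extrema (fun y => derive1 C y ^+ 2) => y y0.
apply: (@continuous_comp _ _ _ (derive1 C) (fun y => y ^+ 2)).
  apply/differentiable_continuous/derivable1_diffP.
  exact: capacity_derivable2.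
exact: exprn_continuous.
Qed.

Lemma inf_le_derive2_capacity (x : R) : lo <= x <= hi ->
  inf [set derive1n 2 C x * x ^+ 2 * (1 + x) ^+ 2 | x in `[lo, hi]%classic] <=
  derive1n 2 C x * x ^+ 2 * (1 + x) ^+ 2.
Proof.
move=> xi; apply: ge_inf; last by exists x; rewrite //= in_itv.
by have [y y0|//] := @continuous_extrema (derive1n 2 C); exact: capacity_C2.
Qed.

End compact_interval.

End capacity_functions.

(** * The cost of one link as a function of its power share *)

Section link.
Variables (R : realType) (net : network R) (i : node net).
Hypothesis net_ok : network_ok net.
Variable a : 'I_#|out i|.

Let j := nbr a.
Let d := cost i j.
Let C := capacity net.
Let f := flow i j.
Let g := gain i j * power i.
Let IN := interference a.
Let X := sinr a.

Let link_ij : link i j.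
Proof. by have := enum_valP a; rewrite /out inE. Qed.

Let d_ok : cost_function d. Proof. exact: ok_cost. Qed.
Let C_ok : capacity_function C. Proof. exact: ok_capacity. Qed.
Let f_ge0 : 0 <= f. Proof. exact: ok_flow. Qed.
Let g_ge0 : 0 <= g. Proof. by rewrite mulr_ge0 ?ok_gain ?ok_power. Qed.

Lemma background_gt0 : 0 < background a.
Proof.
rewrite ltr_wpDl ?ok_noise// sumr_ge0// => m _.
by rewrite mulr_ge0 ?ok_gain ?ok_power.
Qed.

Lemma interference_gt0 t : t <= 1 -> 0 < IN t.
Proof.
move=> t1; rewrite ltr_wpDl ?background_gt0// mulr_ge0 ?subr_ge0//.
Qed.

(** Only strict inequalities, so that the condition is open: [0 < interference a t] stands in for
    [t <= 1], since differentiating at the share 1 takes a two-sided neighbourhood. *)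
Definition feasible (t : R) : Prop :=
  [/\ 0 < gain i (nbr a) * power i, 0 < t, 0 < interference a t
    & flow i (nbr a) < capacity net (sinr a t)].

(** The real function [h] whose second derivative is the Hessian entry of the link. *)
Definition finite_link_cost (t : R) : R :=
  cost i (nbr a) (capacity net (sinr a t)) (flow i (nbr a)).

Lemma sinr_gt0 t : feasible t -> 0 < X t.
Proof. by move=> [g0 t0 IN0 _]; rewrite divr_gt0// mulr_gt0. Qed.

Lemma link_cost_feasible t :
  feasible t -> link_cost a t = (finite_link_cost t)%:E.
Proof.
move=> ft; have [_ _ _ fC] := ft.
rewrite /link_cost /link_cost_at /link_capacity /extended_capacity.
by rewrite (sinr_gt0 ft) /extended_cost lte_fin fC.
Qed.

(** A nonpositive [sinr] means capacity [-oo], hence infinite cost. Finite cost thus forces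
    [0 < g * t], which [0 <= g] splits into [0 < g] and [0 < t]. *)
Lemma feasible_fin_num t : t <= 1 -> link_cost a t \is a fin_num -> feasible t.
Proof.
move=> t1.
rewrite /link_cost /link_cost_at /link_capacity /extended_capacity.
case: (ltP 0 (sinr a t)) => [X0|_]; rewrite /extended_cost; last first.
  by rewrite ltNge leNye.
rewrite lte_fin; case: ifPn => // fC _.
have IN0 := interference_gt0 t1.
have := X0; rewrite /sinr pmulr_lgt0 ?invr_gt0// => gt0.
have g0 : 0 < g.
  by rewrite lt_def g_ge0 andbT; apply: contraTneq gt0 => g0;
    rewrite -/j -/g g0 mul0r ltxx.
by split=> //; rewrite -(pmulr_rgt0 _ g0).
Qed.

Lemma finite_link_cost_ge0 t : feasible t -> 0 <= finite_link_cost t.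
Proof. by case=> _ _ _ fC; apply: (cost_ge0 d_ok); rewrite f_ge0. Qed.

(** A larger share raises the received signal and does not raise the interference, which contains
    the power given to the other links. *)
Lemma sinr_increasing t t' : feasible t -> t < t' -> t' <= 1 -> X t < X t'.
Proof.
move=> [g0 t0 INt _] tt' t'1.
have INle : IN t' <= IN t.
  by rewrite /IN /interference lerD2r ler_wpM2l// lerD2l lerN2 ltW.
apply: (@lt_le_trans _ _ (g * t' / IN t)).
  by rewrite ltr_pM2r ?invr_gt0// ltr_pM2l.
apply: ler_wpM2l; first exact: mulr_ge0 (ltW g0) (ltW (lt_trans t0 tt')).
by rewrite lef_pV2 ?posrE// interference_gt0.
Qed.

Lemma sinr_le_max t : feasible t -> t <= 1 -> X t <= sinr_max a.
Proof.
(* At share 1 the node causes itself no interference. *)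
have -> : sinr_max a = X 1.
  by rewrite /X /sinr /interference subrr mulr0 add0r mulr1.
by move=> ft; rewrite le_eqVlt => /predU1P[->//|t1]; exact/ltW/sinr_increasing.
Qed.

Lemma feasible_ge t t' : feasible t -> t <= t' -> t' <= 1 -> feasible t'.
Proof.
move=> ft; rewrite le_eqVlt => /predU1P[<-//|tt'] t'1.
have [g0 t0 IN0 fC] := ft.
split=> //; [exact: lt_trans tt'|exact: interference_gt0|].
apply: (lt_trans fC); apply: (capacity_increasing C_ok); first exact: sinr_gt0.
exact: sinr_increasing.
Qed.

Lemma finite_link_cost_decreasing t t' :
  feasible t -> t < t' -> t' <= 1 -> finite_link_cost t' < finite_link_cost t.
Proof.
move=> ft tt' t'1; have [_ _ _ fC] := ft.
apply: (cost_decreasing d_ok f_ge0 fC).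
apply: (capacity_increasing C_ok); first exact: sinr_gt0.
exact: sinr_increasing.
Qed.

(** The derivative [x'] of the [sinr], obtained from [IN' = - g]. *)
Let slope t := g / IN t * (1 + X t).

Lemma interference_is_derive (t : R) : is_derive t 1 IN (- g).
Proof.
rewrite /IN /interference.
apply: is_derive_eq; rewrite /GRing.scale /= -/j -/g; ring.
Qed.

Lemma sinr_is_derive (t : R) : 0 < IN t -> is_derive t 1 X (slope t).
Proof.
move=> IN0; have IN0' : IN t != 0 by rewrite gt_eqF.
have dI := interference_is_derive t.
have dV := is_deriveV IN0' dI.
have -> : X = (fun t => g * t) * (fun t => (IN t)^-1) by [].
apply: is_derive_eq; rewrite /slope /X /sinr /= /GRing.scale /=.
by rewrite -/IN -/g; field.
Qed.

(** Each of the factors [g / IN] and [1 + x] has derivative [g / IN] times itself, hence the 2. *)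
Lemma slope_is_derive (t : R) :
  0 < IN t -> is_derive t 1 slope (2 * (g / IN t) * slope t).
Proof.
move=> IN0; have IN0' : IN t != 0 by rewrite gt_eqF.
have dI := interference_is_derive t.
have dV := is_deriveV IN0' dI.
have dX := sinr_is_derive IN0.
rewrite (_ : is_derive t 1 slope =
  is_derive t 1 ((fun t => g * (IN t)^-1) * (fun t => 1 + X t)))//.
apply: is_derive_eq; rewrite /slope /X /sinr /= /GRing.scale /=.
by rewrite -/IN -/g; field.
Qed.

Lemma capacity_sinr_is_derive (t : R) : feasible t ->
  is_derive t 1 (C \o X) (derive1 C (X t) * slope t).
Proof.
move=> ft; have [_ _ IN0 _] := ft.
have dX := sinr_is_derive IN0.
have dC := capacity_is_derive C_ok (sinr_gt0 ft).
exact: is_derive1_comp.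
Qed.

Lemma near_feasible t : feasible t -> \forall t' \near t, feasible t'.
Proof.
move=> ft; have [g0 t0 IN0 fC] := ft.
have cont h l : is_derive t 1 h l -> {for t, continuous (h : R -> R)}.
  by case=> dh _; apply/differentiable_continuous/derivable1_diffP.
have /cont cI := interference_is_derive t.
have /cont cC := capacity_sinr_is_derive ft.
near=> t'; split=> //; near: t'.
- exact: lt_nbhsr.
- exact: (cI _ (lt_nbhsr IN0)).
- exact: (cC _ (lt_nbhsr fC)).
Unshelve. all: by end_near. Qed.

(** The derivative [h'] by the chain rule; it is [power i] times [marginal_cost]. *)
Let marginal t := dcap d (C (X t)) f * (derive1 C (X t) * slope t).

Lemma finite_link_cost_derive1 t :
  feasible t -> derive1 finite_link_cost t = marginal t.
Proof.
move=> ft; have [_ _ _ fC] := ft.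
have dC := capacity_sinr_is_derive ft.
have dd := cost_is_derive d_ok f_ge0 fC.
have [_ E] := @is_derive1_comp _ (d^~ f) (C \o X) t _ _ dd dC.
by rewrite derive1E; exact: E.
Qed.

Lemma finite_link_cost_derive2 t : feasible t ->
  derive1 (derive1 finite_link_cost) t =
  dcap (dcap d) (C (X t)) f * (derive1 C (X t) * slope t) ^+ 2 +
  dcap d (C (X t)) f * (derive1n 2 C (X t) * slope t ^+ 2 +
    derive1 C (X t) * (2 * (g / IN t) * slope t)).
Proof.
move=> ft; have [_ _ IN0 fC] := ft.
have dX := sinr_is_derive IN0.
have ds := slope_is_derive IN0.
have dC := capacity_sinr_is_derive ft.
have dd := @is_derive1_comp _ ((dcap d)^~ f) (C \o X) t _ _
  (dcap_is_derive d_ok f_ge0 fC) dC.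
have dC' := @is_derive1_comp _ (derive1 C) X t _ _
  (derive1_capacity_is_derive C_ok (sinr_gt0 ft)) dX.
(* Differentiating [h'] takes its formula on a neighbourhood of [t], which openness of feasibility
   provides. *)
rewrite derive1E (@near_eq_derive _ _ _ _
    (((dcap d)^~ f \o (C \o X)) * ((derive1 C \o X) * slope))); last first.
  by apply: filterS (near_feasible ft) => t' /finite_link_cost_derive1.
rewrite derive_val /GRing.scale /=.
by rewrite -[(_ * slope) t]/(derive1 C (X t) * slope t); ring.
Qed.

(** As [g / IN = x / t], this form yields the factor [t^-2] and the weights [x^2 (1 + x)^2] of
    [beta]. *)
Lemma slope_sinr t : feasible t -> slope t = X t * (1 + X t) / t.
Proof.
move=> [g0 t0 IN0 _]; rewrite /slope /X /sinr -/IN -/g.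
by field; rewrite !gt_eqF.
Qed.

Lemma finite_link_cost_curvature (D low t : R) :
  has_ubound (curvatures a D%:E) ->
  feasible low -> finite_link_cost low = D ->
  low <= t -> t <= 1 ->
  derive1 (derive1 finite_link_cost) t <= beta a D%:E low.
Proof.
move=> ub low_feasible lowD lowt t1.
have ft := feasible_ge low_feasible lowt t1.
have [g0 low0 _ fClow] := low_feasible; have [_ t0 INt0 fC] := ft.
have Xlow := sinr_gt0 low_feasible; have X0 := sinr_gt0 ft.
have [Xle dle] : X low <= X t /\ d (C (X t)) f <= D.
  rewrite -lowD; move: lowt; rewrite le_eqVlt => /predU1P[<-//|lt_low_t].
  by split; apply/ltW;
    [exact: sinr_increasing|exact: finite_link_cost_decreasing].
have Xin : X low <= X t <= sinr_max a by rewrite Xle sinr_le_max.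
(* The capacity at [low] has cost [D], so the [get] in [level_capacity] satisfies its defining
   equation; finiteness of the cost puts it above the flow. *)
have [flevel levelD] : f < level_capacity a D%:E /\
    d (level_capacity a D%:E) f = D.
  have : link_cost_at a (level_capacity a D%:E)%:E = D%:E.
    apply: (@getPex _ [set c : R | link_cost_at a c%:E = D%:E]).
    exists (C (X low)); rewrite /= /link_cost_at /extended_cost lte_fin fClow/=.
    by rewrite -lowD.
  by rewrite /link_cost_at /extended_cost lte_fin; case: ifPn => // ? [].
(* At [t] the link costs at most [D], so its capacity is at least the level capacity, and [d_c] at
   least its value there. *)
have level_le : level_capacity a D%:E <= C (X t).
  by apply: (capacity_le_of_cost_ge d_ok f_ge0 fC); rewrite levelD.
have dcap_le := dcap_nondecreasing d_ok f_ge0 flevel level_le.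
have dcap_lt0 : dcap d (C (X t)) f < 0.
  by apply: (cost_dcap_lt0 d_ok); rewrite f_ge0.
have dcap2_ge0 : 0 <= dcap (dcap d) (C (X t)) f.
  by apply: (cost_dcap2_ge0 d_ok); rewrite f_ge0.
have B_ge : dcap (dcap d) (C (X t)) f <= sup (curvatures a D%:E).
  apply: ub_le_sup => //; exists (C (X t)) => //=.
  by rewrite /link_cost_at /extended_cost lte_fin fC/= lee_fin.
have supC := derive1_capacity_le_sup C_ok Xlow Xin.
have infC := inf_le_derive2_capacity C_ok Xlow Xin.
have C1 := derive1_capacity_ge0 C_ok X0.
have C2 := derive2_capacity_le0 C_ok X0.
have s0 : 0 <= slope t.
  apply: mulr_ge0; first exact: divr_ge0 (ltW g0) (ltW INt0).
  exact: addr_ge0 ler01 (ltW X0).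
rewrite finite_link_cost_derive2// /beta -/C -/X -/d -/f.
set u : R := derive1 C (X t) ^+ 2 * _ * _ in supC.
set w := derive1n 2 C (X t) * _ * _ in infC.
have u0 : 0 <= u.
  exact: mulr_ge0 (mulr_ge0 (sqr_ge0 _) (sqr_ge0 _)) (sqr_ge0 _).
have w0 : w <= 0.
  exact: mulr_le0_ge0 (mulr_le0_ge0 C2 (sqr_ge0 _)) (sqr_ge0 _).
(* The intermediate bound drops the nonpositive term [d_c C' x'']. *)
apply: (@le_trans _ _ ((t ^+ 2)^-1 *
    (dcap (dcap d) (C (X t)) f * u + dcap d (C (X t)) f * w))).
  have -> : (t ^+ 2)^-1 *
      (dcap (dcap d) (C (X t)) f * u + dcap d (C (X t)) f * w) =
      dcap (dcap d) (C (X t)) f * (derive1 C (X t) * slope t) ^+ 2 +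
      dcap d (C (X t)) f * (derive1n 2 C (X t) * slope t ^+ 2).
    by rewrite slope_sinr// /u /w; field; rewrite gt_eqF.
  rewrite lerD2l ler_nM2l// lerDl; apply: mulr_ge0 C1 (mulr_ge0 _ s0).
  exact: mulr_ge0 (ler0n _ 2) (divr_ge0 (ltW g0) (ltW INt0)).
(* All factors are nonnegative, and [low <= t] compares the inverse squares. *)
apply: ler_pM.
- by rewrite invr_ge0 sqr_ge0.
- apply: addr_ge0; first exact: mulr_ge0.
  exact: mulr_le0 (ltW dcap_lt0) w0.
- by rewrite lef_pV2 ?posrE ?exprn_gt0// ler_pXn2r// nnegrE ltW.
apply: lerD; first exact: ler_pM.
(* Both products have two nonpositive factors, so they are compared through their opposites. *)
rewrite -[X in X <= _]mulrNN -[X in _ <= X]mulrNN.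
by rewrite ler_pM ?oppr_ge0 ?lerN2 ?(ltW dcap_lt0).
Qed.

End link.

(** * The network cost around an allocation and the bound on its Hessian *)

Lemma simplex_le1 (R : realType) (net : network R) (i : node net)
    (y : alloc i) a :
  simplex y -> y 0 a <= 1.
Proof.
by move=> [y_ge0 <-]; rewrite (bigD1 a)//= lerDl sumr_ge0.
Qed.

Section network.
Variables (R : realType) (net : network R) (i : node net).
Variable eta : forall m : node net, alloc m.
Hypothesis net_ok : network_ok net.
Hypothesis cost_fin : network_cost eta \is a fin_num.

Lemma local_cost_fin_num m : local_cost (eta m) \is a fin_num.
Proof. by have /sum_fin_numP := cost_fin; apply; rewrite ?mem_index_enum. Qed.

Lemma link_cost_fin_num m a : link_cost a (eta m 0 a) \is a fin_num.
Proof.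
by have /sum_fin_numP := local_cost_fin_num m; apply; rewrite ?mem_index_enum.
Qed.

Lemma local_cost_feasible (y : alloc i) : (forall a, feasible a (y 0 a)) ->
  local_cost y = (\sum_a finite_link_cost a (y 0 a))%:E.
Proof.
move=> fy; rewrite -sumEFin; apply: eq_bigr => a _.
exact: link_cost_feasible.
Qed.

(** The other nodes contribute a constant, finite as part of a finite network cost, so [fine] splits
    the sum. *)
Lemma cost_of_alloc_feasible (y : alloc i) :
  (forall a, feasible a (y 0 a)) ->
  cost_of_alloc eta y = fine (\sum_(m | m != i) local_cost (eta m))%E +
                        \sum_a finite_link_cost a (y 0 a).
Proof.
move=> fy; rewrite /cost_of_alloc /network_cost (bigD1 i)//= dfwithin.
rewrite local_cost_feasible// (eq_bigr (fun m => local_cost (eta m))).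
  rewrite fineD//= 1?addrC//; apply/sum_fin_numP => m _ _.
  exact: local_cost_fin_num.
by move=> m mi; rewrite dfwithout// eq_sym.
Qed.

Lemma hessian_cost_of_alloc (z : alloc i) : (forall a, feasible a (z 0 a)) ->
  hessian (cost_of_alloc eta (i := i)) z =
  diag_mx (\row_a derive1 (derive1 (finite_link_cost a)) (z 0 a)).
Proof.
move=> fz.
have near_z a : nbhs z [set y : 'rV_#|out i| | feasible a (y 0 a)].
  exact: (@coord_continuous _ _ _ 0 a z _ (near_feasible net_ok (fz a))).
apply: hessian_separable.
apply: filterS (@filter_forall _ _ _ (nbhs z) _ near_z) => y.
exact: cost_of_alloc_feasible.
Qed.

(** Were [low] above the current share, the local cost, which is the link cost at [low], would be
    less than the current cost of this link, one of its nonnegative summands. *)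
Lemma cost_level_le_alloc (low : R) a : simplex (eta i) ->
  feasible a low -> low <= 1 ->
  link_cost a low = local_cost (eta i) -> low <= eta i 0 a.
Proof.
move=> eta_simplex low_feasible low1 costE.
have feta b : feasible b (eta i 0 b).
  by apply: feasible_fin_num; rewrite ?simplex_le1// link_cost_fin_num.
rewrite leNgt; apply/negP => lt_low.
have := finite_link_cost_decreasing net_ok (feta a) lt_low low1.
move: costE; rewrite link_cost_feasible// local_cost_feasible// => -[->].
rewrite (bigD1 a)//= ltNge lerDl sumr_ge0// => b _.
exact: finite_link_cost_ge0.
Qed.

End network.

(** The guard [0 < #|out m|] excludes nodes without outgoing links, whose empty sum of shares cannot
    be 1. Bounded [curvatures] express that the maximum B_ij is finite. *)
Theorem lemma3 (R : realType) (net : network R) (i : node net)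
    (eta : forall m : node net, alloc m)
    (Q : 'M[R]_#|out i|) (eta_next eta_low : alloc i) :
  network_ok net ->
  (forall m : node net, (0 < #|out m|)%N -> simplex (eta m)) ->
  network_cost eta \is a fin_num ->
  power_allocation_step Q (eta i) eta_next ->
  (forall a : 'I_#|out i|,
     link_cost a (eta_low 0 a) = local_cost (eta i) /\
     eta_low 0 a <= eta_next 0 a) ->
  (forall a : 'I_#|out i|, has_ubound (curvatures a (local_cost (eta i)))) ->
  forall lambda : R, 0 <= lambda <= 1 ->
  forall v : 'rV[R]_#|out i|, \sum_a v 0 a = 0 ->
  quad (hessian (cost_of_alloc eta (i := i))
          (lambda *: eta i + (1 - lambda) *: eta_next)) v
  <= quad (beta_mx (local_cost (eta i)) eta_low) v.
Proof.
move=> net_ok eta_simplex cost_fin [next_simplex _] low_spec bounded lambda.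
move=> /andP[lambda_ge0 lambda_le1] v _.
set z : alloc i := lambda *: _ + _.
have local_fin := local_cost_fin_num cost_fin i.
(* [eta_low] is below the next allocation by assumption and below the current one by
   [cost_level_le_alloc], hence below the whole segment; the bound 1 passes to the segment
   likewise. *)
have [low_feasible low_le_z z_le1] : [/\
    forall a, feasible a (eta_low 0 a), forall a, eta_low 0 a <= z 0 a
  & forall a, z 0 a <= 1].
  split=> a; have [costE low_le_next] := low_spec a;
    have next_le1 := simplex_le1 a next_simplex;
    have eta_i := eta_simplex i (leq_ltn_trans (leq0n _) (ltn_ord a));
    have low_le1 := le_trans low_le_next next_le1;
    have low_feas : feasible a (eta_low 0 a)
      by apply: feasible_fin_num; rewrite // costE.
  - by [].
  - have := cost_level_le_alloc net_ok cost_fin eta_i low_feas low_le1 costE.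
    by rewrite /z !mxE; nra.
  - by have := simplex_le1 a eta_i; rewrite /z !mxE; nra.
rewrite hessian_cost_of_alloc// => [|a]; last first.
  exact: (feasible_ge net_ok (low_feasible a) (low_le_z a) (z_le1 a)).
rewrite !quad_diag_mx ler_sum// => a _; rewrite !mxE ler_wpM2r ?sqr_ge0//.
have [costE _] := low_spec a.
have := low_le_z a; have := z_le1 a; rewrite !mxE => za_le1 low_le_za.
rewrite -(fineK local_fin).
apply: finite_link_cost_curvature => //; first by rewrite fineK.
by rewrite -costE link_cost_feasible.
Qed.
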